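(* The $3\times3$ Pearson correlation map (equivalently $T$) has no periodic orbit of prime period greater than one. More generally, for every $p\in\mathcal E_3^{\mathrm{nd}}$, the omega-limit set $\omega(p)$ is a singleton consisting of a fixed point of $T$.
   Context: For nonconstant $x,y\in\mathbb R^3$, with means $\bar x,\bar y$, the Pearson correlation is $\operatorname{corr}(x,y)=\frac{\sum_k(x_k-\bar x)(y_k-\bar y)}{\sqrt{\sum_k(x_k-\bar x)^2\sum_k(y_k-\bar y)^2}}$. For a real $3\times3$ matrix $A$ with nonconstant rows $r_1,r_2,r_3$, the correlation map is $[C(A)]_{ij}=\operatorname{corr}(r_i,r_j)$. For real $a,b,c$ let $A(a,b,c)=\begin{pmatrix} 1 & a & b \\ a & 1 & c \\ b & c & 1 \end{pmatrix}$. Let $\mathcal E_3=\{(a,b,c)\in[-1,1]^3:1+2abc-a^2-b^2-c^2\ge0\}$, and let $\mathcal E_3^{\mathrm{nd}}$ be the set of $(a,b,c)\in\mathcal E_3$ such that all rows of $A(a,b,c)$ are nonconstant; one has $\mathcal E_3^{\mathrm{nd}}=\mathcal E_3\setminus\{(1,1,1)\}$. The map $T:\mathcal E_3^{\mathrm{nd}}\to\mathcal E_3^{\mathrm{nd}}$ is defined by $A(T(p))=C(A(p))$, and $T^k$ is its $k$-th iterate. For $p\in\mathcal E_3^{\mathrm{nd}}$, $\omega(p)=\{p_\infty\in\mathcal E_3:\text{there exist }k_j\to\infty\text{ with }T^{k_j}(p)\to p_\infty\}$ (accumulation points are taken in the compact set $\mathcal E_3$). *)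

(* Defs.v *)
(* Uses MathComp and MathComp-Analysis. *)
From mathcomp Require Import all_boot all_order all_algebra.
From mathcomp Require Import all_classical all_reals all_analysis.
From mathcomp Require Import ring lra.

Set Implicit Arguments.
Unset Strict Implicit.
Unset Printing Implicit Defensive.

Import Order.TTheory GRing.Theory Num.Theory.
Import numFieldNormedType.Exports.

Local Open Scope classical_set_scope.
Local Open Scope ring_scope.

Section Pearson.
Variable R : realType.
Implicit Types (x y : 'rV[R]_3) (A : 'M[R]_3) (p q : R * R * R).

Definition nonconstant x : Prop := exists i j : 'I_3, x 0 i <> x 0 j.

Definition mean x : R := (\sum_(k < 3) x 0 k) / 3%:R.

(* When [x] or [y] is constant the denominator vanishes and the value is 0. *)
Definition corr x y : R :=
  (\sum_(k < 3) (x 0 k - mean x) * (y 0 k - mean y)) /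
  Num.sqrt ((\sum_(k < 3) (x 0 k - mean x) ^+ 2) *
            (\sum_(k < 3) (y 0 k - mean y) ^+ 2)).

Definition nonconstant_rows : set 'M[R]_3 :=
  [set A | forall i : 'I_3, nonconstant (row i A)].

(* Total on matrices; the correlation map proper is its restriction to
   [nonconstant_rows], which it does not preserve (equal rows are sent to the
   all-ones matrix). *)
Definition corr_map A : 'M[R]_3 :=
  \matrix_(i < 3, j < 3) corr (row i A) (row j A).

Definition A3 p : 'M[R]_3 :=
  let: (a, b, c) := p in
  \matrix_(i < 3, j < 3)
    nth 0 (nth [::] [:: [:: 1; a; b];
                        [:: a; 1; c];
                        [:: b; c; 1]] i) j.

Definition E3 : set (R * R * R) :=
  [set p | let: (a, b, c) := p in
    [/\ -1 <= a <= 1, -1 <= b <= 1, -1 <= c <= 1 &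
        0 <= 1 + 2 * a * b * c - a ^+ 2 - b ^+ 2 - c ^+ 2]].

Definition E3nd : set (R * R * R) :=
  [set p | E3 p /\ nonconstant_rows (A3 p)].

(* Total on triples; [A3_T] and [T_E3nd] below show that on [E3nd] it is the
   self-map characterized by A3 (T p) = corr_map (A3 p). *)
Definition T p : R * R * R :=
  let B := corr_map (A3 p) in
  (B (inord 0) (inord 1), B (inord 0) (inord 2), B (inord 1) (inord 2)).

Definition omega p : set (R * R * R) :=
  [set q | E3 q /\
    exists k : nat -> nat,
      k @ \oo --> \oo /\ (fun j => iter (k j) T p) @ \oo --> q].

(* [f] is a partial self-map of [X] with domain [D], so the whole orbit is
   required to stay in [D]. *)
Definition prime_period (X : Type) (D : set X) (f : X -> X) (x : X) (m : nat)
    : Prop :=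
  [/\ (0 < m)%N, forall n, D (iter n f x), iter m f x = x &
      forall n, (0 < n < m)%N -> iter n f x <> x].

Let o0 : 'I_3 := inord 0.
Let o1 : 'I_3 := inord 1.
Let o2 : 'I_3 := inord 2.

Let sum3 (F : 'I_3 -> R) : \sum_(k < 3) F k = F o0 + F o1 + F o2.
Proof.
rewrite !big_ord_recl big_ord0 addr0 addrA.
by congr (F _ + F _ + F _); apply/val_inj; rewrite /= inordK.
Qed.

Let ord3P (P : 'I_3 -> Prop) : P o0 -> P o1 -> P o2 -> forall i, P i.
Proof.
move=> P0 P1 P2 [[|[|[|//]]] lti];
  [move: P0|move: P1|move: P2]; congr P; apply/val_inj; rewrite /= inordK //.
Qed.

Let sq x := \sum_(k < 3) (x 0 k - mean x) ^+ 2.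

Let unit_vec x k := (x 0 k - mean x) / Num.sqrt (sq x).

Let sq_gt0 x : nonconstant x -> 0 < sq x.
Proof.
move=> [i [j xij]]; rewrite lt_def sumr_ge0 ?andbT; last first.
  by move=> k _; rewrite sqr_ge0.
apply/negP => /eqP /psumr_eq0P s0; apply: xij.
have z k : x 0 k = mean x.
  apply/eqP; rewrite -subr_eq0 -sqrf_eq0; apply/eqP/s0 => // l _.
  by rewrite sqr_ge0.
by rewrite !z.
Qed.

Let corrE x y : corr x y = \sum_(k < 3) unit_vec x k * unit_vec y k.
Proof.
rewrite /corr -/(sq x) -/(sq y) sqrtrM; last first.
  by apply: sumr_ge0 => k _; rewrite sqr_ge0.
by rewrite invfM big_distrl /=; apply: eq_bigr => k _; rewrite mulrACA.
Qed.

Lemma corrC x y : corr x y = corr y x.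
Proof. by rewrite !corrE; apply: eq_bigr => k _; rewrite mulrC. Qed.

Lemma corrxx x : nonconstant x -> corr x x = 1.
Proof.
move=> /sq_gt0 s; rewrite /corr -/(sq x) -expr2 sqrtr_sqr gtr0_norm //.
by rewrite divff // gt_eqF.
Qed.

Lemma A3_T p : nonconstant_rows (A3 p) -> A3 (T p) = corr_map (A3 p).
Proof.
move=> nc; apply/matrixP; apply: ord3P; apply: ord3P;
  rewrite /T [LHS]mxE [LHS]/= !inordK //= !mxE ?corrxx //; exact: corrC.
Qed.

Let corr_itv x y : nonconstant x -> nonconstant y -> -1 <= corr x y <= 1.
Proof.
move=> /corrxx + /corrxx; rewrite !corrE !sum3.
set u0 := unit_vec x o0; set u1 := unit_vec x o1; set u2 := unit_vec x o2.
set v0 := unit_vec y o0; set v1 := unit_vec y o1; set v2 := unit_vec y o2.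
move=> hu hv.
have := sqr_ge0 (u0 + v0); have := sqr_ge0 (u1 + v1).
have := sqr_ge0 (u2 + v2); have := sqr_ge0 (u0 - v0).
have := sqr_ge0 (u1 - v1); have := sqr_ge0 (u2 - v2).
rewrite !expr2 => h1 h2 h3 h4 h5 h6; apply/andP; split; lra.
Qed.

Let corr1 x y : nonconstant x -> nonconstant y -> corr x y = 1 ->
  unit_vec x =1 unit_vec y.
Proof.
move=> /corrxx hx /corrxx hy hxy.
have s0 : \sum_k (unit_vec x k - unit_vec y k) ^+ 2 = 0.
  by move: hx hy hxy; rewrite !corrE !sum3 !expr2 => *; lra.
move=> k; apply/eqP; rewrite -subr_eq0 -sqrf_eq0; apply/eqP.
by apply: (psumr_eq0P _ s0) => // l _; rewrite sqr_ge0.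
Qed.

Let E3_T p : nonconstant_rows (A3 p) -> E3 (T p).
Proof.
move=> nc; rewrite /T /E3 /= !mxE.
have := (nc o0, nc o1, nc o2); rewrite /o0 /o1 /o2.
set x := row (inord 0) _; set y := row (inord 1) _; set z := row (inord 2) _.
move=> [[nx ny] nz]; split; [exact: corr_itv..|].
move: nx ny nz => /corrxx + /corrxx + /corrxx; rewrite !corrE !sum3.
set u0 := unit_vec x o0; set u1 := unit_vec x o1; set u2 := unit_vec x o2.
set v0 := unit_vec y o0; set v1 := unit_vec y o1; set v2 := unit_vec y o2.
set w0 := unit_vec z o0; set w1 := unit_vec z o1; set w2 := unit_vec z o2.
move=> hu hv hw.
set a := _ + u2 * v2; set b := _ + u2 * w2; set c := _ + v2 * w2.
pose U := u0 * u0 + u1 * u1 + u2 * u2.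
pose V := v0 * v0 + v1 * v1 + v2 * v2.
pose W := w0 * w0 + w1 * w1 + w2 * w2.
have gram : U * V * W + 2 * a * b * c - a ^+ 2 * W - b ^+ 2 * V - c ^+ 2 * U =
    (u0 * (v1 * w2 - v2 * w1) - u1 * (v0 * w2 - v2 * w0)
     + u2 * (v0 * w1 - v1 * w0)) ^+ 2.
  by rewrite /U /V /W /a /b /c; ring.
by move: gram; rewrite /U /V /W hu hv hw !mulr1 => ->; exact: sqr_ge0.
Qed.

Lemma T_E3nd p : E3nd p -> E3nd (T p).
Proof.
move=> [Ep nc]; split; first exact: E3_T.
rewrite A3_T // => i; apply: contrapT => ci.
have eq1 j : corr (row i (A3 p)) (row j (A3 p)) = 1.
  apply: contrapT => ne1; apply: ci; exists j, i.
  by rewrite !mxE (corrxx (nc i)).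
have equ j k : unit_vec (row j (A3 p)) =1 unit_vec (row k (A3 p)).
  by move=> l; rewrite -(corr1 (nc i) (nc j)) // -(corr1 (nc i) (nc k)).
have le1 j k : A3 p j k <= 1.
  case: p Ep {nc ci eq1 equ} => [[a b] c] [/andP[_ a1] /andP[_ b1] /andP[_ c1] _].
  by move: j; apply: ord3P; move: k; apply: ord3P; rewrite mxE !inordK.
have sym j k : A3 p j k = A3 p k j.
  case: p {Ep nc ci eq1 equ le1} => [[a b] c].
  by move: j; apply: ord3P; move: k; apply: ord3P; rewrite !mxE !inordK.
have diag j : A3 p j j = 1.
  case: p {Ep nc ci eq1 equ le1 sym} => [[a b] c].
  by move: j; apply: ord3P; rewrite mxE !inordK.
have all1 j k : A3 p j k = 1.
  have sj : 0 < (Num.sqrt (sq (row j (A3 p))))^-1.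
    by rewrite invr_gt0 sqrtr_gt0 sq_gt0.
  have sk : 0 < (Num.sqrt (sq (row k (A3 p))))^-1.
    by rewrite invr_gt0 sqrtr_gt0 sq_gt0.
  apply/le_anti; rewrite le1 /= leNgt; apply/negP => lt1.
  have := equ j k j; have := equ j k k; rewrite /unit_vec.
  move: sj sk; set s := _^-1; set t := _^-1 => s0 t0.
  set m := mean _; set n := mean _; rewrite ![row _ _ _ _]mxE !diag (sym k j).
  move: lt1; set d := A3 p j k => lt1; nra.
by have [j [k]] := nc o0; rewrite !mxE !all1.
Qed.

End Pearson.

(* Main.v *)
Require Import Defs.
From mathcomp Require Import all_boot all_order all_algebra.
From mathcomp Require Import all_classical all_reals all_analysis.
From mathcomp Require Import ring lra.
Import Order.TTheory GRing.Theory Num.Theory.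
Import numFieldNormedType.Exports.
Local Open Scope classical_set_scope.
Local Open Scope ring_scope.

(** After one application of the correlation map every triple (a, b, c) consists
of the cosines of the angles between three unit vectors v1, v2, v3 of a plane,
because the three centred rows lie in the plane of sum-zero vectors. Let
  p = v2 x v3,  q = v3 x v1,  r = v1 x v2
be their cross products. The relation p v1 + q v2 + r v3 = 0 makes |p|, |q|, |r|
the sides of a triangle, possibly flat, with a, b, c given by the law of
cosines.

If S is the scatter matrix of the three points, a step of T replaces each vi by
S^(1/2) vi, normalised; hence it multiplies p, q, r by n1, n2, n3, up to a
common factor proportional to p + q + r, where ni is the length of S^(1/2) vi,
that is, of the centred i-th row (gram_step). The identity
  n1^2 - n2^2 = const * (p - q) (p + q + r)
(row_var_diff) says that, when p + q + r >= 0, the larger cross product is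
stretched more. Reordering the vectors and reversing the orientation, one may assume
p >= q >= r and q >= 0; then p + q + r >= 0 by the triangle inequality, and the
order is preserved for ever.

If q > 0, the law of cosines turns this into monotonicity
(ordered_gram_step): a decreases, and c increases or decreases according to the
sign of r, which does not change. Both converge, and b = a c - p r follows since p
and r are, up to that fixed sign, square roots of 1 - c^2 and 1 - a^2. If r = 0
the law of cosines says nothing about c, but then v1 = - v2 and the step is an
explicit function of c (opposite_pair_stretch). The limit is not the excluded
point (1, 1, 1), because a < 1 at the start and a decreases. If q = 0 the triple
is sent in one step to a fixed point with entries 1 and -1 (collapse_settles).

So every orbit converges to a point other than (1, 1, 1); by continuity of T it is a fixed
point. A periodic orbit that converges is constant, and a periodic orbit of
matrices consists of correlation matrices, so it is an orbit of T. *)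

Set Implicit Arguments.
Unset Strict Implicit.
Unset Printing Implicit Defensive.

Section CorrelationDynamics.
Context {R : realType}.
Implicit Types (a b c x y z p q r e : R) (s l : R * R * R).

(** * The map in coordinates *)

Lemma sum_ord3 (F : 'I_3 -> R) :
  \sum_(k < 3) F k = F (inord 0) + F (inord 1) + F (inord 2).
Proof.
rewrite !big_ord_recl big_ord0 addr0 addrA.
by congr (F _ + F _ + F _); apply/val_inj; rewrite /= inordK.
Qed.

Lemma ord3_ind (P : 'I_3 -> Prop) :
  P (inord 0) -> P (inord 1) -> P (inord 2) -> forall i, P i.
Proof.
move=> P0 P1 P2 [[|[|[|//]]] lti];
  [move: P0|move: P1|move: P2]; congr P; apply/val_inj; rewrite /= inordK //.
Qed.

(** Centred sum of squares of the row (1, x, y), up to the factor 2/3, which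
cancels in correlations; the factor of row_cov is the same. *)
Definition row_var x y := 1 + x ^+ 2 + y ^+ 2 - x - y - x * y.

(** Centred inner product of the rows (1, x, y) and (x, 1, z), up to 2/3. *)
Definition row_cov x y z :=
  (4 * x + 2 * y * z - 1 - y - z - x ^+ 2 - x * y - x * z) / 2.

Definition row_corr x y z :=
  row_cov x y z / Num.sqrt (row_var x y * row_var x z).

Lemma T_row_corr a b c :
  T (a, b, c) = (row_corr a b c, row_corr b a c, row_corr c a b).
Proof.
have sqrt_scale u v :
    Num.sqrt (2 / 3 * u * (2 / 3 * v)) = 2 / 3 * Num.sqrt (u * v) :> R.
  by rewrite mulrACA -expr2 sqrtrM ?sqr_ge0 // sqrtr_sqr ger0_norm.
have scaled u v w : (2 / 3 * u) / Num.sqrt (2 / 3 * v * (2 / 3 * w)) =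
    u / Num.sqrt (v * w) :> R.
  by rewrite sqrt_scale invfM mulrACA divff ?mul1r.
rewrite /T /row_corr; congr (_, _, _);
  rewrite mxE /corr /mean !sum_ord3 !mxE !inordK //=;
  rewrite -[RHS]scaled; (congr (_ / Num.sqrt (_ * _)));
  by rewrite /row_var /row_cov; field.
Qed.

(** These are the cosines a = v1.v2, b = v1.v3, c = v2.v3 and the cross products
p = v2 x v3, q = v3 x v1, r = v1 x v2 of unit plane vectors: the 3 x 3 Gram
matrix of the vi has rank at most 2, and its adjugate is
(p, q, r)^T (p, q, r). Carrying p, q, r along fixes their signs, which the
squares 1 - c^2, 1 - b^2, 1 - a^2 forget. *)
Definition planar_gram a b c p q r : Prop :=
  [/\ p ^+ 2 = 1 - c ^+ 2, q ^+ 2 = 1 - b ^+ 2, r ^+ 2 = 1 - a ^+ 2 &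
   [/\ p * q = b * c - a, p * r = a * c - b & q * r = a * b - c]].

(** Dividing unnormalised vectors of lengths l, m, n by their lengths: the
hypotheses say that p, q, r are the cross products of vectors with inner
products x, y, z. Serves both an arbitrary matrix and a step of T. *)
Lemma gram_normalize (l m n : R) x y z p q r :
  l != 0 -> m != 0 -> n != 0 ->
  p ^+ 2 = m ^+ 2 * n ^+ 2 - z ^+ 2 ->
  q ^+ 2 = l ^+ 2 * n ^+ 2 - y ^+ 2 ->
  r ^+ 2 = l ^+ 2 * m ^+ 2 - x ^+ 2 ->
  p * q = y * z - x * n ^+ 2 ->
  p * r = x * z - y * m ^+ 2 ->
  q * r = x * y - z * l ^+ 2 ->
  planar_gram (x / (l * m)) (y / (l * n)) (z / (m * n))
       (p / (m * n)) (q / (l * n)) (r / (l * m)).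
Proof.
move=> l0 m0 n0 pp qq rr pq pr qr.
have sqE f g u v : u != 0 -> v != 0 -> f ^+ 2 = u ^+ 2 * v ^+ 2 - g ^+ 2 ->
    (f / (u * v)) ^+ 2 = 1 - (g / (u * v)) ^+ 2 :> R.
  by move=> u0 v0 h; rewrite expr_div_n h; field; rewrite u0 v0.
have prE (f g i j k u v w : R) : u != 0 -> v != 0 -> w != 0 ->
    f * g = i * j - k * w ^+ 2 ->
    f / (v * w) * (g / (u * w)) = i / (u * w) * (j / (v * w)) - k / (u * v).
  move=> u0 v0 w0 h.
  have -> : f / (v * w) * (g / (u * w)) = f * g / (u * v * w ^+ 2).
    by field; rewrite u0 v0 w0.
  by rewrite h; field; rewrite u0 v0 w0.
split; [exact: sqE|exact: sqE|exact: sqE|split].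
- exact: prE.
- by rewrite [m * n]mulrC; exact: prE.
- by rewrite [l * n]mulrC [l * m]mulrC; exact: prE.
Qed.

(** Centred vectors of R^3 lie in the plane of sum-zero vectors, and the first
two coordinates describe that plane; the factor sqrt 3 below is the area
distortion of these coordinates. *)
Lemma corr_gram (x y z : 'rV[R]_3) :
  nonconstant x -> nonconstant y -> nonconstant z ->
  exists p q r, planar_gram (corr x y) (corr x z) (corr y z) p q r.
Proof.
pose d (u : 'rV[R]_3) k := u 0 (inord k) - mean u.
have d2 u : d u 2 = - d u 0 - d u 1.
  by rewrite /d /mean sum_ord3; field.
pose s u v := 2 * d u 0 * d v 0 + 2 * d u 1 * d v 1 + d u 0 * d v 1 + d u 1 * d v 0.
have sum_s (u v : 'rV[R]_3) :
    \sum_(k < 3) (u 0 k - mean u) * (v 0 k - mean v) = s u v.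
  rewrite sum_ord3 -/(d u 0) -/(d u 1) -/(d u 2) -/(d v 0) -/(d v 1) -/(d v 2).
  by rewrite !d2 /s; ring.
have sum_sq (u : 'rV[R]_3) : \sum_(k < 3) (u 0 k - mean u) ^+ 2 = s u u.
  by rewrite -sum_s; apply: eq_bigr => k _; rewrite expr2.
have s_ge0 u : 0 <= s u u.
  by rewrite -sum_sq; apply: sumr_ge0 => k _; exact: sqr_ge0.
have corrE u v : corr u v = s u v / (Num.sqrt (s u u) * Num.sqrt (s v v)).
  by rewrite /corr sum_s !sum_sq sqrtrM.
have n_neq0 u : nonconstant u -> Num.sqrt (s u u) != 0.
  move=> /corrxx h; apply/eqP => n0; move: h.
  rewrite corrE n0 mulr0 invr0 mulr0 => /eqP.
  by rewrite eq_sym oner_eq0.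
have nE u : Num.sqrt (s u u) ^+ 2 = s u u.
  by rewrite sqr_sqrtr.
move=> /n_neq0 hx /n_neq0 hy /n_neq0 hz; rewrite !corrE.
move: (nE x) (nE y) (nE z) hx hy hz.
set l := Num.sqrt (s x x); set m := Num.sqrt (s y y); set n := Num.sqrt (s z z).
move=> lE mE nE' hx hy hz.
pose t : R := Num.sqrt 3.
have tE : t ^+ 2 = 3 by rewrite sqr_sqrtr.
pose cr u v := d u 0 * d v 1 - d u 1 * d v 0.
exists (t * cr y z / (m * n)), (t * cr z x / (l * n)), (t * cr x y / (l * m)).
have sqE f : (t * f) ^+ 2 = 3 * f ^+ 2 by rewrite exprMn tE.
have prE f g : t * f * (t * g) = 3 * (f * g) by rewrite -tE; ring.
by apply: gram_normalize; rewrite // ?sqE ?prE ?lE ?mE ?nE' /s /cr; ring.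
Qed.

(** * Cosines and cross products of plane vectors *)

Lemma row_varC x y : row_var x y = row_var y x.
Proof. by rewrite /row_var; ring. Qed.

Lemma row_covC x y z : row_cov x y z = row_cov x z y.
Proof. by rewrite /row_cov; ring. Qed.

Lemma row_corrC x y z : row_corr x y z = row_corr x z y.
Proof. by rewrite /row_corr row_covC mulrC [row_var x y * _]mulrC mulrC. Qed.

Lemma row_varE x y :
  row_var x y = ((1 - x) ^+ 2 + (1 - y) ^+ 2 + (x - y) ^+ 2) / 2.
Proof. by rewrite /row_var; field. Qed.

Lemma row_var_gt0 x y : (x != 1) || (y != 1) -> 0 < row_var x y.
Proof.
move=> xy; rewrite row_varE divr_gt0 // ltr_wpDr ?sqr_ge0 //.
case/orP: xy => h; [apply: ltr_wpDr|apply: ltr_wpDl]; rewrite ?sqr_ge0 //;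
  by rewrite exprn_even_gt0 //= subr_eq0 eq_sym.
Qed.

(** Exchanging two of the vi reverses all orientations, but p, q, r need only
be known up to a common sign, so the swaps come out without signs. *)
Lemma gram_swap12 a b c p q r : planar_gram a b c p q r -> planar_gram b a c p r q.
Proof. by case=> pp qq rr [pq pr qr]; split; rewrite // [r * q]mulrC [b * a]mulrC. Qed.

Lemma gram_swap23 a b c p q r : planar_gram a b c p q r -> planar_gram a c b q p r.
Proof. by case=> pp qq rr [pq pr qr]; split; rewrite // [q * p]mulrC [c * b]mulrC. Qed.

Lemma gram_opp a b c p q r : planar_gram a b c p q r ->
  planar_gram a b c (- p) (- q) (- r).
Proof. by case=> pp qq rr [pq pr qr]; split; rewrite ?sqrrN ?mulrNN. Qed.

Lemma gram_det a b c p q r : planar_gram a b c p q r ->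
  1 + 2 * a * b * c - a ^+ 2 - b ^+ 2 - c ^+ 2 = 0.
Proof.
case=> pp qq rr [pq pr qr].
have : p ^+ 2 * q ^+ 2 = (p * q) ^+ 2 by ring.
by rewrite pp qq pq => h; lra.
Qed.

Lemma gram_E3 a b c p q r : planar_gram a b c p q r -> E3 (a, b, c).
Proof.
move=> g; have d := gram_det g; case: g => pp qq rr _.
have itv (u v : R) : u ^+ 2 = 1 - v ^+ 2 -> -1 <= v <= 1.
  by move=> h; have := sqr_ge0 u; rewrite h => ?; apply/andP; split; nra.
by split; rewrite ?d //; [exact: itv rr|exact: itv qq|exact: itv pp].
Qed.

(** Expand the square of r v3 = - (p v1 + q v2). *)
Lemma gram_cosine a b c p q r : planar_gram a b c p q r ->
  r ^+ 2 = p ^+ 2 + q ^+ 2 + 2 * a * (p * q).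
Proof.
move=> g; have d := gram_det g; case: g => pp qq rr [pq _ _].
by rewrite pp qq rr pq; lra.
Qed.

(** The relation p v1 + q v2 + r v3 = 0 persists after applying S^(1/2), whose
effect on inner products is given by row_var and row_cov. *)
Lemma gram_cosine_step a b c p q r : planar_gram a b c p q r ->
  r ^+ 2 * row_var b c = p ^+ 2 * row_var a b + q ^+ 2 * row_var a c
                         + 2 * row_cov a b c * (p * q).
Proof.
move=> g; have d := gram_det g; case: g => pp qq rr [pq _ _].
rewrite pp qq rr pq; apply/eqP; rewrite -subr_eq0 -oppr_eq0; apply/eqP.
(* The defect of this identity is the multiple 1 - a of the determinant. *)
transitivity ((1 - a) * (1 + 2 * a * b * c - a ^+ 2 - b ^+ 2 - c ^+ 2)).
  by rewrite /row_var /row_cov; field.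
by rewrite d mulr0.
Qed.

(** If p + q + r >= 0, the larger cross product belongs to the longer centred row.
This drives the dynamics, as the step multiplies the cross products by the
lengths of these rows. *)
Lemma row_var_diff a b c p q r : planar_gram a b c p q r ->
  row_var a b - row_var a c = (p - q) * (p + q + r).
Proof.
case=> pp qq rr [pq pr qr].
have -> : (p - q) * (p + q + r) = p ^+ 2 - q ^+ 2 + p * r - q * r by ring.
by rewrite pp qq pr qr /row_var; ring.
Qed.

(** Stretching the sides p, q, r of a triangle by n1 >= n2 >= n3, where q <= p,
closes the angle opposite r. Here a is minus the cosine of that angle, and
g / (n1 n2) is its new value. *)
Lemma cosine_least_stretched p q r n1 n2 n3 a g :
  0 < q <= p -> 0 <= n3 <= n2 -> n2 <= n1 ->
  r ^+ 2 = p ^+ 2 + q ^+ 2 + 2 * a * (p * q) ->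
  r ^+ 2 * n3 ^+ 2 = p ^+ 2 * n1 ^+ 2 + q ^+ 2 * n2 ^+ 2 + 2 * g * (p * q) ->
  g <= a * (n1 * n2).
Proof.
move=> /andP[q0 qp] /andP[n30 n32] n21 rE rnE.
have pq0 : 0 < 2 * (p * q) by rewrite !mulr_gt0 // (lt_le_trans q0).
rewrite -subr_ge0 -(pmulr_rge0 _ pq0).
have -> : 2 * (p * q) * (a * (n1 * n2) - g) =
    (n1 - n2) * (p ^+ 2 * n1 - q ^+ 2 * n2) + r ^+ 2 * (n1 * n2 - n3 ^+ 2).
  have aE : 2 * a * (p * q) = r ^+ 2 - p ^+ 2 - q ^+ 2 by rewrite rE; ring.
  have gE : 2 * g * (p * q) = r ^+ 2 * n3 ^+ 2 - p ^+ 2 * n1 ^+ 2 - q ^+ 2 * n2 ^+ 2.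
    by rewrite rnE; ring.
  transitivity (2 * a * (p * q) * (n1 * n2) - 2 * g * (p * q)); first by ring.
  by rewrite aE gE; ring.
have n20 := le_trans n30 n32.
rewrite addr_ge0 // mulr_ge0 ?sqr_ge0 ?subr_ge0 //.
  by rewrite ler_pM ?sqr_ge0 // lerXn2r ?nnegrE // ltW // (lt_le_trans q0).
by rewrite expr2 ler_pM // (le_trans n32).
Qed.

(** Under the same stretching the angle opposite p opens. The sides are q and |r|,
so c is minus the cosine of this angle if r > 0 and the cosine if r < 0: the
sign of q r decides in which direction c moves. *)
Lemma cosine_most_stretched p q r n1 n2 n3 c g :
  0 <= q <= p -> 0 <= n3 <= n2 -> n2 <= n1 ->
  p ^+ 2 = q ^+ 2 + r ^+ 2 + 2 * c * (q * r) ->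
  p ^+ 2 * n1 ^+ 2 = q ^+ 2 * n2 ^+ 2 + r ^+ 2 * n3 ^+ 2 + 2 * g * (q * r) ->
  0 <= (q * r) * (g - c * (n2 * n3)).
Proof.
move=> /andP[q0 qp] /andP[n30 n32] n21 pE pnE.
have n20 := le_trans n30 n32.
rewrite -(pmulr_rge0 _ (ltr0Sn R 1)).
have -> : 2 * (q * r * (g - c * (n2 * n3))) =
  p ^+ 2 * (n1 ^+ 2 - n2 ^+ 2) + (p ^+ 2 - q ^+ 2) * (n2 * (n2 - n3))
  + r ^+ 2 * (n3 * (n2 - n3)).
  have cE : 2 * c * (q * r) = p ^+ 2 - q ^+ 2 - r ^+ 2 by rewrite pE; ring.
  have gE : 2 * g * (q * r) = p ^+ 2 * n1 ^+ 2 - q ^+ 2 * n2 ^+ 2 - r ^+ 2 * n3 ^+ 2.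
    by rewrite pnE; ring.
  transitivity (2 * g * (q * r) - 2 * c * (q * r) * (n2 * n3)); first by ring.
  by rewrite cE gE; ring.
have sq_le (u v : R) : 0 <= u -> u <= v -> 0 <= v ^+ 2 - u ^+ 2.
  by move=> u0 uv; rewrite subr_ge0 lerXn2r ?nnegrE // (le_trans u0).
have n2330 : 0 <= n2 - n3 by rewrite subr_ge0.
apply: addr_ge0; [apply: addr_ge0|]; apply: mulr_ge0;
  by [exact: sqr_ge0|exact: sq_le|exact: mulr_ge0].
Qed.

(** * One step from an ordered triangle *)

(** The cofactors of the matrix M of centred inner products are products of the
entries of the adjugate of A: with P = I - J / 3, where J is the all-ones
matrix, M = A P A and adj P = J / 3, so
adj M = (adj A) J (adj A) / 3, and every row of adj A has sum p, q or r times
p + q + r. The factor sqrt 3 / 2 accounts for the scaling of row_var. *)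
Lemma gram_step a b c p q r : planar_gram a b c p q r ->
  0 < row_var a b -> 0 < row_var a c -> 0 < row_var b c ->
  let n1 := Num.sqrt (row_var a b) in let n2 := Num.sqrt (row_var a c) in
  let n3 := Num.sqrt (row_var b c) in
  let k := Num.sqrt 3 / 2 * (p + q + r) in
  planar_gram (row_corr a b c) (row_corr b a c) (row_corr c a b)
       (k * p / (n2 * n3)) (k * q / (n1 * n3)) (k * r / (n1 * n2)).
Proof.
move=> g m1 m2 m3 n1 n2 n3 k.
have nE u v : 0 < row_var u v -> Num.sqrt (row_var u v) ^+ 2 = row_var u v.
  by move=> /ltW h; rewrite sqr_sqrtr.
have n0 u v : 0 < row_var u v -> Num.sqrt (row_var u v) != 0.
  by move=> h; rewrite gt_eqF // sqrtr_gt0.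
have kk f h : k * f * (k * h) = 3 / 4 * (f * (p + q + r)) * (h * (p + q + r)).
  transitivity ((Num.sqrt 3) ^+ 2 / 4 * (f * (p + q + r)) * (h * (p + q + r))).
    by rewrite /k; field.
  by rewrite sqr_sqrtr.
have k2 f : (k * f) ^+ 2 = 3 / 4 * (f * (p + q + r)) ^+ 2 by rewrite expr2 kk; ring.
rewrite /row_corr [row_var b a]row_varC [row_var c a]row_varC [row_var c b]row_varC.
rewrite (@sqrtrM _ (row_var a b)) ?ltW // (@sqrtrM _ (row_var a b)) ?ltW //.
rewrite (@sqrtrM _ (row_var a c)) ?ltW // -/n1 -/n2 -/n3.
case: g => pp qq rr [pq pr qr].
have pE : p * (p + q + r) = 1 - c ^+ 2 + (b * c - a) + (a * c - b).
  by rewrite -pp -pq -pr; ring.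
have qE : q * (p + q + r) = (b * c - a) + (1 - b ^+ 2) + (a * b - c).
  by rewrite -qq -pq -qr; ring.
have rE : r * (p + q + r) = (a * c - b) + (a * b - c) + (1 - a ^+ 2).
  by rewrite -rr -pr -qr; ring.
apply: gram_normalize; rewrite ?n0 // !nE // ?kk ?k2 ?pE ?qE ?rE;
  by rewrite /row_var /row_cov; field.
Qed.

(** Every triple can be brought to this form, up to q = 0, by permuting the
vectors and changing the common sign of p, q, r; at most r is negative. *)
Definition ordered_gram a b c p q r :=
  [/\ planar_gram a b c p q r, q <= p, r <= q & 0 < q].

(** The last bound is half of the strict triangle inequality |r| < p + q, which
follows from a < 1 because (p + q)^2 - r^2 = 2 p q (1 - a). *)
Lemma ordered_gram_lt1 a b c p q r : ordered_gram a b c p q r ->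
  [/\ a < 1, b != 1, c != 1 & 0 < p + q + r].
Proof.
case=> g qp rq q0; have p0 := lt_le_trans q0 qp.
have pq0 : 0 < p * q by exact: mulr_gt0.
have rE := gram_cosine g; case: (g) => pp qq rr _.
have r2 : 0 <= 1 - a ^+ 2 by rewrite -rr sqr_ge0.
have sq0 (u v : R) : 0 < u -> u ^+ 2 = 1 - v ^+ 2 -> v != 1.
  move=> u0 uv; apply: contraTneq u0 => v1; move: uv.
  by rewrite v1 expr1n subrr => /eqP; rewrite sqrf_eq0 => /eqP ->; rewrite ltxx.
have a1 : a < 1 by nra.
split; rewrite ?(sq0 _ _ q0 qq) ?(sq0 _ _ p0 pp) //.
rewrite ltNge; apply/negP => s0.
have : (p + q) ^+ 2 - r ^+ 2 <= 0 by nra.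
have -> : (p + q) ^+ 2 - r ^+ 2 = 2 * (p * q) * (1 - a) by rewrite rE; ring.
by rewrite leNgt !mulr_gt0 ?subr_gt0.
Qed.

(** The order of the sides orders the lengths of the centred rows, which in
turn preserves the order of the sides. For r = 0 the last inequality is void. *)
Lemma ordered_gram_step a b c p q r : ordered_gram a b c p q r ->
  let a' := row_corr a b c in let b' := row_corr b a c in
  let c' := row_corr c a b in
  exists p' q' r', [/\ ordered_gram a' b' c' p' q' r',
    exists2 t, 0 < t & r' = t * r, a' <= a & 0 <= r * (c' - c)].
Proof.
move=> og a' b' c'; have [a1 b1 c1 s0] := ordered_gram_lt1 og.
case: og => g qp rq q0; have p0 := lt_le_trans q0 qp.
have m1 : 0 < row_var a b by rewrite row_var_gt0 // b1 orbT.
have m2 : 0 < row_var a c by rewrite row_var_gt0 // c1 orbT.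
have m3 : 0 < row_var b c by rewrite row_var_gt0 // b1.
have := gram_step g m1 m2 m3 => /=; rewrite -/a' -/b' -/c'.
have g321 := gram_swap23 (gram_swap12 (gram_swap23 g)).
have le12 : row_var a c <= row_var a b.
  by rewrite -subr_ge0 (row_var_diff g) mulr_ge0 ?subr_ge0 // ltW.
have le23 : row_var b c <= row_var a c.
  rewrite -subr_ge0 -oppr_le0 opprB [row_var b c]row_varC [row_var a c]row_varC.
  by rewrite (row_var_diff g321) mulr_le0_ge0 ?subr_le0 //; lra.
set n1 := Num.sqrt (row_var a b); set n2 := Num.sqrt (row_var a c).
set n3 := Num.sqrt (row_var b c); set k := _ * (p + q + r) => g'.
have n10 : 0 < n1 by rewrite sqrtr_gt0.
have n20 : 0 < n2 by rewrite sqrtr_gt0.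
have n30 : 0 < n3 by rewrite sqrtr_gt0.
have n12 : n2 <= n1 by exact: ler_wsqrtr.
have n23 : n3 <= n2 by exact: ler_wsqrtr.
have nE1 : n1 ^+ 2 = row_var a b by rewrite sqr_sqrtr // ltW.
have nE2 : n2 ^+ 2 = row_var a c by rewrite sqr_sqrtr // ltW.
have nE3 : n3 ^+ 2 = row_var b c by rewrite sqr_sqrtr // ltW.
have k0 : 0 < k by rewrite /k mulr_gt0 // divr_gt0 // sqrtr_gt0.
have a'E : a' = row_cov a b c / (n1 * n2).
  by rewrite /a' /row_corr sqrtrM // ltW.
have c'E : c' = row_cov c a b / (n2 * n3).
  by rewrite /c' /row_corr ![row_var c _]row_varC sqrtrM // ltW.
exists (k * p / (n2 * n3)), (k * q / (n1 * n3)), (k * r / (n1 * n2)); split.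
- split=> //.
  + rewrite ler_pdivlMr ?mulr_gt0 // mulrAC ler_pdivrMr ?mulr_gt0 //.
    rewrite -subr_ge0.
    have -> : k * p * (n1 * n3) - k * q * (n2 * n3) = k * n3 * (p * n1 - q * n2).
      by ring.
    apply: mulr_ge0; first by rewrite ltW // mulr_gt0.
    by rewrite subr_ge0 ler_pM // ltW.
  + rewrite ler_pdivlMr ?mulr_gt0 // mulrAC ler_pdivrMr ?mulr_gt0 //.
    rewrite -subr_ge0.
    have -> : k * q * (n1 * n2) - k * r * (n1 * n3) = k * n1 * (q * n2 - r * n3).
      by ring.
    apply: mulr_ge0; first by rewrite ltW // mulr_gt0.
    rewrite subr_ge0.
    by rewrite (le_trans (y := q * n3)) // ?ler_pM2r // ?ler_pM2l.
  + by rewrite divr_gt0 ?mulr_gt0.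
- by exists (k / (n1 * n2)); [rewrite divr_gt0 ?mulr_gt0|ring].
- rewrite a'E ler_pdivrMr ?mulr_gt0 //.
  apply: (@cosine_least_stretched p q r n1 n2 n3); rewrite ?q0 ?(ltW n30) //.
    exact: gram_cosine g.
  by rewrite nE1 nE2 nE3; exact: gram_cosine_step g.
- have : 0 <= q * r * (row_cov c a b - c * (n2 * n3)).
    apply: (@cosine_most_stretched p q r n1 n2 n3); rewrite ?(ltW q0) ?(ltW n30) //.
      by rewrite (gram_cosine g321); ring.
    rewrite nE1 nE2 nE3; have := gram_cosine_step g321.
    rewrite [row_var b a]row_varC [row_var c b]row_varC [row_var c a]row_varC.
    by rewrite row_covC => ->; ring.
  have -> : q * r * (row_cov c a b - c * (n2 * n3)) = q * (n2 * n3) * (r * (c' - c)).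
    by rewrite c'E; field; rewrite !gt_eqF.
  by rewrite pmulr_rge0 // !mulr_gt0.
Qed.

(** * The excluded point and continuity *)

(** When two of the entries are 1, the determinant is minus the square of one
minus the third entry. *)
Lemma E3_two_ones a b c : E3 (a, b, c) -> (a, b, c) <> (1, 1, 1) ->
  [/\ (a != 1) || (b != 1), (a != 1) || (c != 1) & (b != 1) || (c != 1)].
Proof.
case=> _ _ _ d ne.
have two (u v w : R) : 0 <= 1 + 2 * u * v * w - u ^+ 2 - v ^+ 2 - w ^+ 2 ->
    u = 1 -> v = 1 -> w = 1.
  move=> + u1 v1; rewrite u1 v1 => h; apply/eqP; rewrite -subr_eq0 -sqrf_eq0.
  by rewrite eq_le sqr_ge0 andbT; lra.
by split; rewrite -negb_and; apply/negP => /andP[/eqP h1 /eqP h2]; apply: ne;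
  rewrite ?h1 ?h2; congr (_, _, _); (apply: two; [|exact: h1|exact: h2]); lra.
Qed.

Lemma E3_row_var_gt0 a b c : E3 (a, b, c) -> (a, b, c) <> (1, 1, 1) ->
  [/\ 0 < row_var a b, 0 < row_var a c & 0 < row_var b c].
Proof. by move=> e ne; case: (E3_two_ones e ne); split; exact: row_var_gt0. Qed.

Lemma E3ndP (s : R * R * R) : E3nd s <-> E3 s /\ s <> (1, 1, 1).
Proof.
case: s => [[a b] c]; split=> -[e h]; split=> //.
  move=> [a1 b1 c1]; have [i [j]] := h (inord 0); apply.
  rewrite !mxE a1 b1 inordK //.
  by move: i j; apply: ord3_ind; apply: ord3_ind; rewrite !inordK.
have [ab ac bc] := E3_two_ones e h.
have nc i u v k1 k2 k3 : A3 (a, b, c) i k1 = 1 -> A3 (a, b, c) i k2 = u ->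
    A3 (a, b, c) i k3 = v -> (u != 1) || (v != 1) -> nonconstant (row i (A3 (a, b, c))).
  by move=> e1 e2 e3 /orP[] /eqP ne; [exists k2, k1|exists k3, k1];
    rewrite ![row _ _ _ _]mxE e1 ?e2 ?e3.
apply: ord3_ind.
- by apply: (nc _ a b (inord 0) (inord 1) (inord 2)); rewrite ?mxE ?inordK.
- by apply: (nc _ a c (inord 1) (inord 0) (inord 2)); rewrite ?mxE ?inordK.
- by apply: (nc _ b c (inord 2) (inord 0) (inord 1)); rewrite ?mxE ?inordK.
Qed.

Lemma cvg_sqr (u : nat -> R) x :
  u @ \oo --> x -> (fun k => u k ^+ 2) @ \oo --> x ^+ 2.
Proof. by move=> ux; rewrite expr2; under eq_fun do rewrite expr2; exact: cvgM. Qed.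

Lemma cvg_row_corr (f g h : nat -> R) x y z :
  f @ \oo --> x -> g @ \oo --> y -> h @ \oo --> z ->
  0 < row_var x y -> 0 < row_var x z ->
  (fun k => row_corr (f k) (g k) (h k)) @ \oo --> row_corr x y z.
Proof.
move=> fx gy hz v1 v2.
have var (u v : nat -> R) (l m : R) : u @ \oo --> l -> v @ \oo --> m ->
    (fun k => row_var (u k) (v k)) @ \oo --> row_var l m.
  move=> ul vm; rewrite /row_var.
  by repeat first [exact: ul|exact: vm|exact: cvg_cst|
    apply: cvg_sqr|apply: cvgB|apply: cvgD|apply: cvgM].
apply: cvgM.
  rewrite /row_cov.
  by repeat first [exact: fx|exact: gy|exact: hz|exact: cvg_cst|
    apply: cvg_sqr|apply: cvgB|apply: cvgD|apply: cvgM].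
apply: cvgV; first by rewrite gt_eqF // sqrtr_gt0 mulr_gt0.
apply: continuous_cvg; first exact: sqrt_continuous.
by apply: cvgM; exact: var.
Qed.

(** The limit is only required to avoid the excluded point; that it is a fixed
point is then a consequence of continuity. *)
Definition settles (s : R * R * R) :=
  exists2 l : R * R * R, l <> (1, 1, 1) & (fun k => iter k (@T R) s) @ \oo --> l.

Lemma cvg_triple (f g h : nat -> R) x y z :
  f @ \oo --> x -> g @ \oo --> y -> h @ \oo --> z ->
  (fun k => (f k, g k, h k)) @ \oo --> (x, y, z).
Proof. by move=> fx gy hz; exact: (cvg_pair (cvg_pair fx gy) hz). Qed.

Lemma cvg_tripleP (u : nat -> R * R * R) x y z : u @ \oo --> (x, y, z) ->
  [/\ (fun k => (u k).1.1) @ \oo --> x, (fun k => (u k).1.2) @ \oo --> y &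
      (fun k => (u k).2) @ \oo --> z].
Proof.
move=> uL; have u1 : (fun k => (u k).1) @ \oo --> (x, y).
  by apply: (cvg_comp _ _ uL); exact: cvg_fst.
split; [apply: (cvg_comp _ _ u1); exact: cvg_fst|
        apply: (cvg_comp _ _ u1); exact: cvg_snd|
        apply: (cvg_comp _ _ uL); exact: cvg_snd].
Qed.

Lemma T_swap12 (s : R * R * R) :
  T (s.1.2, s.1.1, s.2) = ((T s).1.2, (T s).1.1, (T s).2).
Proof. by case: s => [[a b] c]; rewrite !T_row_corr [row_corr c b a]row_corrC. Qed.

Lemma T_swap23 (s : R * R * R) :
  T (s.1.1, s.2, s.1.2) = ((T s).1.1, (T s).2, (T s).1.2).
Proof. by case: s => [[a b] c]; rewrite !T_row_corr [row_corr a c b]row_corrC. Qed.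

Lemma settles_swap12 a b c : settles (a, b, c) -> settles (b, a, c).
Proof.
move=> [[[x y] z] ne /cvg_tripleP[ux uy uz]]; exists (y, x, z).
  by move=> [y1 x1 z1]; apply: ne; rewrite x1 y1 z1.
have -> : (fun k => iter k (@T R) (b, a, c)) =
    fun k => let s := iter k (@T R) (a, b, c) in (s.1.2, s.1.1, s.2).
  by apply/funext => k; elim: k => //= k ->; exact: T_swap12.
exact: cvg_triple.
Qed.

Lemma settles_swap23 a b c : settles (a, b, c) -> settles (a, c, b).
Proof.
move=> [[[x y] z] ne /cvg_tripleP[ux uy uz]]; exists (x, z, y).
  by move=> [x1 z1 y1]; apply: ne; rewrite x1 y1 z1.
have -> : (fun k => iter k (@T R) (a, c, b)) =
    fun k => let s := iter k (@T R) (a, b, c) in (s.1.1, s.2, s.1.2).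
  by apply/funext => k; elim: k => //= k ->; exact: T_swap23.
exact: cvg_triple.
Qed.

(** If the middle one of the sorted cross products is negative, changing all
signs and reversing the order makes it positive. *)
Lemma settles_sorted :
  (forall a b c p q r, planar_gram a b c p q r -> (a, b, c) <> (1, 1, 1) ->
     q <= p -> r <= q -> 0 <= q -> settles (a, b, c)) ->
  forall a b c p q r, planar_gram a b c p q r -> (a, b, c) <> (1, 1, 1) ->
    settles (a, b, c).
Proof.
move=> ordered.
have chain a b c p q r : planar_gram a b c p q r -> (a, b, c) <> (1, 1, 1) ->
    q <= p -> r <= q -> settles (a, b, c).
  move=> g ne qp rq; have [q0|q0] := leP 0 q; first exact: ordered g _ _ _ _.
  apply/settles_swap12/settles_swap23/settles_swap12.
  apply: (ordered _ _ _ (- r) (- q) (- p)); rewrite ?lerN2 ?oppr_ge0 ?(ltW q0) //.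
    by apply/gram_opp/gram_swap12/gram_swap23/gram_swap12.
  by move=> [c1 b1 a1]; apply: ne; rewrite a1 b1 c1.
have top a b c p q r : planar_gram a b c p q r -> (a, b, c) <> (1, 1, 1) ->
    q <= p -> r <= p -> settles (a, b, c).
  move=> g ne qp rp; have [rq|/ltW qr] := leP r q; first exact: chain g _ _ _.
  apply/settles_swap12; apply: chain (gram_swap12 g) _ rp qr.
  by move=> [b1 a1 c1]; apply: ne; rewrite a1 b1 c1.
move=> a b c p q r g ne.
have top2 a' b' c' p' q' r' : planar_gram a' b' c' p' q' r' ->
    (a', b', c') <> (1, 1, 1) -> p' <= q' -> r' <= q' -> settles (a', b', c').
  move=> g' ne' pq rq; apply/settles_swap23.
  apply: top (gram_swap23 g') _ pq rq.
  by move=> [a1 c1 b1]; apply: ne'; rewrite a1 b1 c1.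
have [qp|/ltW pq] := leP q p; have [rp|/ltW pr] := leP r p.
- exact: top g ne qp rp.
- apply/settles_swap12; apply: top2 (gram_swap12 g) _ pr (le_trans qp pr).
  by move=> [b1 a1 c1]; apply: ne; rewrite a1 b1 c1.
- exact: top2 g ne pq (le_trans rp pq).
- have [rq|/ltW qr] := leP r q; first exact: top2 g ne pq rq.
  apply/settles_swap12; apply: top2 (gram_swap12 g) _ pr qr.
  by move=> [b1 a1 c1]; apply: ne; rewrite a1 b1 c1.
Qed.

(** * Monotone convergence of ordered orbits *)

(** A step of T when v1 = - v2, so that a = -1 and b = - c. The factor 4 / sqrt v is at
least 1 because v = (3 + c^2) (1 + 3 c^2) <= 16. *)
Lemma opposite_pair_stretch c : c ^+ 2 <= 1 ->
  exists2 t, 1 <= t & row_corr c (-1) (- c) = t * c.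
Proof.
move=> c1; set v := row_var c (-1) * row_var c (- c).
have vE : v = 3 + 10 * c ^+ 2 + 3 * (c ^+ 2) ^+ 2 by rewrite /v /row_var; ring.
have v0 : 0 < v by rewrite vE; have := sqr_ge0 c; nra.
have v16 : v <= 4 ^+ 2 by rewrite vE; have := sqr_ge0 c; nra.
exists (4 / Num.sqrt v).
  rewrite ler_pdivlMr ?sqrtr_gt0 // mul1r.
  by rewrite -[leRHS](ger0_norm (ler0n _ 4)) -sqrtr_sqr ler_wsqrtr.
by rewrite /row_corr -/v [RHS]mulrAC; congr (_ / _); rewrite /row_cov; field.
Qed.

(** The sign e is that of r. When r = 0 the angle between v1 and v2 is flat and
the sign of c takes over, so that in all cases e * c increases along orbits. *)
Definition oriented e (s : R * R * R) := exists p q r,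
  [/\ ordered_gram s.1.1 s.1.2 s.2 p q r, 0 <= e * r & r = 0 -> 0 <= e * s.2].

Lemma ordered_oriented a b c p q r : ordered_gram a b c p q r ->
  exists2 e, e ^+ 2 = 1 & oriented e (a, b, c).
Proof.
move=> og; have [r0|r0|r0] := ltrgt0P r.
- exists 1; first exact: expr1n.
  by exists p, q, r; split=> //=; [rewrite mul1r ltW|
    move=> r0'; move: r0; rewrite r0' ltxx].
- exists (-1); first by rewrite sqrrN expr1n.
  by exists p, q, r; split=> //=; [rewrite mulN1r oppr_ge0 ltW|
    move=> r0'; move: r0; rewrite r0' ltxx].
have [c0|/ltW c0] := leP 0 c.
- exists 1; first exact: expr1n.
  by exists p, q, r; split=> //=; [rewrite r0 mulr0|rewrite mul1r].
- exists (-1); first by rewrite sqrrN expr1n.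
  by exists p, q, r; split=> //=; [rewrite r0 mulr0|rewrite mulN1r oppr_ge0].
Qed.

Lemma oriented_step e s : e ^+ 2 = 1 -> oriented e s ->
  [/\ oriented e (T s), (T s).1.1 <= s.1.1 & e * s.2 <= e * (T s).2].
Proof.
case: s => [[a b] c] e2; rewrite T_row_corr => -[p [q [r [/= og er rc]]]].
have [p' [q' [r' [og' [t t0 r'E] a'a rc']]]] := ordered_gram_step og.
have er' : 0 <= e * r' by rewrite r'E mulrCA mulr_ge0 // ltW.
have [r0|r0] := eqVneq r 0; last first.
  split=> //.
    exists p', q', r'; split=> //= r'0; move: r'0; rewrite r'E => /eqP.
    by rewrite mulf_eq0 (negPf r0) gt_eqF.
  have er0 : 0 < e * r.
    rewrite lt_def er mulf_neq0 //; apply: contra_eq_neq e2 => ->.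
    by rewrite expr0n eq_sym oner_neq0.
  rewrite -subr_ge0 -mulrBr -(pmulr_rge0 _ er0).
  have -> : e * r * (e * (row_corr c a b - c)) = e ^+ 2 * (r * (row_corr c a b - c)).
    by ring.
  by rewrite e2 mul1r.
(* Here r = 0 and a < 1, so the first two vectors are opposite. *)
have [a1 _ _ _] := ordered_gram_lt1 og.
case: og => -[pp _ rr [_ pr _]] qp _ q0.
have p0 := lt_le_trans q0 qp.
have aE : a = -1.
  move: rr; rewrite r0 expr0n /= => /esym /eqP; rewrite subr_eq0 eq_sym sqrf_eq1.
  by move=> /orP[] /eqP // a1'; move: a1; rewrite a1' ltxx.
have bE : b = - c by move: pr; rewrite r0 mulr0 aE => ?; lra.
have c21 : c ^+ 2 <= 1 by rewrite -subr_ge0 -pp sqr_ge0.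
have [u u1 cE] := opposite_pair_stretch c21.
have ec := rc r0.
have ecE : e * c <= e * row_corr c a b.
  by rewrite aE bE cE mulrCA ler_peMl.
split=> //; exists p', q', r'; split=> //= _; exact: le_trans ec ecE.
Qed.

(** Two cosines and the orientation determine the third cosine, continuously;
this replaces a monotonicity statement for b. *)
Lemma oriented_recover e s : e ^+ 2 = 1 -> oriented e s ->
  s.1.2 = s.1.1 * s.2 - e * (Num.sqrt (1 - s.1.1 ^+ 2) * Num.sqrt (1 - s.2 ^+ 2)).
Proof.
case: s => [[a b] c] e2 [p [q [r [[[pp _ rr [_ pr _]] qp _ q0] er _]]]] /=.
have p0 := ltW (lt_le_trans q0 qp).
have -> : Num.sqrt (1 - a ^+ 2) = e * r.
  by rewrite -rr -[r ^+ 2]mul1r -e2 -exprMn sqrtr_sqr ger0_norm.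
rewrite -pp sqrtr_sqr ger0_norm // mulrA mulrA -expr2 e2 mul1r [r * p]mulrC pr.
by rewrite /=; ring.
Qed.

Lemma nonincreasing_iter_cvg (X : Type) (f : X -> X) (D : set X) (phi : X -> R)
    (m : R) (s : X) : (forall u, D u -> D (f u)) ->
  (forall u, D u -> phi (f u) <= phi u) -> (forall u, D u -> m <= phi u) ->
  D s -> exists2 l, l <= phi s & (fun k => phi (iter k f s)) @ \oo --> l.
Proof.
move=> Df mono lb Ds.
have Dk k : D (iter k f s) by elim: k => //= k /Df.
pose u k := phi (iter k f s).
have nu : nonincreasing_seq u by apply/nonincreasing_seqP => k; exact: mono (Dk k).
have cu : cvgn u.
  by apply: nonincreasing_is_cvgn => //; exists m => _ [k _ <-]; exact: lb (Dk k).
by exists (limn u); [exact: (nonincreasing_cvgn_ge nu cu 0)|exact: cu].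
Qed.

Lemma oriented_settles e s : e ^+ 2 = 1 -> oriented e s -> settles s.
Proof.
move=> e2 os.
have range u : oriented e u -> -1 <= u.1.1 /\ - 1 <= - (e * u.2).
  case: u => [[a b] c] [p [q [r [[/= g _ _ _] _ _]]]] /=.
  have [/andP[a1 _] _ /andP[c1 c2] _] := gram_E3 g; split=> //.
  by move/eqP: e2; rewrite sqrf_eq1 => /orP[] /eqP ->; lra.
have step u : oriented e u -> oriented e (T u) by move=> /(oriented_step e2)[].
have [x xa cx] := nonincreasing_iter_cvg step
  (fun u ou => let: And3 _ h _ := oriented_step e2 ou in h)
  (fun u ou => (range u ou).1) os.
have [|z' _ cz'] := nonincreasing_iter_cvg step _ (fun u ou => (range u ou).2) os.
  by move=> u /(oriented_step e2)[_ _]; rewrite lerN2.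
have cz : (fun k => (iter k (@T R) s).2) @ \oo --> - (e * z').
  have -> : (fun k => (iter k (@T R) s).2) =
      fun k => - (e * - (e * (iter k (@T R) s).2)).
    by apply/funext => k; rewrite mulrN opprK mulrA -expr2 e2 mul1r.
  by apply: cvgN; apply: cvgM => //; exact: cvg_cst.
move: cz; set z := - _ => cz.
have sqrt_co (u : nat -> R) (l : R) : u @ \oo --> l ->
    (fun k => Num.sqrt (1 - u k ^+ 2)) @ \oo --> Num.sqrt (1 - l ^+ 2).
  move=> ul; apply: continuous_cvg; first exact: sqrt_continuous.
  apply: cvgB; first exact: cvg_cst.
  exact: cvg_sqr.
have os_k k : oriented e (iter k (@T R) s) by elim: k => //= k /step.
have cy : (fun k => (iter k (@T R) s).1.2) @ \oo -->
    x * z - e * (Num.sqrt (1 - x ^+ 2) * Num.sqrt (1 - z ^+ 2)).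
  under eq_fun do rewrite (oriented_recover e2 (os_k _)).
  apply: cvgB; first exact: cvgM.
  apply: cvgM; first exact: cvg_cst.
  by apply: cvgM; exact: sqrt_co.
exists (x, x * z - e * (Num.sqrt (1 - x ^+ 2) * Num.sqrt (1 - z ^+ 2)), z);
  last first.
  have := cvg_triple cx cy cz.
  have -> // : (fun k => ((iter k (@T R) s).1.1, (iter k (@T R) s).1.2,
                          (iter k (@T R) s).2)) = fun k => iter k (@T R) s.
  by apply/funext => k; case: (iter _ _ _) => [[]].
move=> [x1 _ _]; move: os xa => [p [q [r [/ordered_gram_lt1[a1 _ _ _] _ _]]]].
by rewrite x1 leNgt a1.
Qed.

(** Vanishing cross products mean that any two of the vectors are equal or
opposite. As they are not all equal, one of them is opposite to the other two. *)
Lemma vertex_fixed a b c : planar_gram a b c 0 0 0 -> (a, b, c) <> (1, 1, 1) ->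
  T (a, b, c) = (a, b, c).
Proof.
case=> c2 b2 a2 [abc _ _] ne.
have pm (u : R) : 0 ^+ 2 = 1 - u ^+ 2 -> u = 1 \/ u = -1.
  rewrite expr0n /= => /esym/eqP; rewrite subr_eq0 eq_sym sqrf_eq1.
  by move=> /orP[]/eqP ->; [left|right].
have aE : a = b * c by move: abc; rewrite mul0r => ?; lra.
have sqrt16 : Num.sqrt (4 * 4) = 4 :> R by rewrite -expr2 sqrtr_sqr ger0_norm.
have corrE x y z g : row_cov x y z = 4 * g -> row_var x y = 4 -> row_var x z = 4 ->
    row_corr x y z = g.
  by move=> h v w; rewrite /row_corr v w sqrt16 h mulrC mulKf.
rewrite T_row_corr.
move: aE ne; have [->|->] := pm _ b2; have [->|->] := pm _ c2 => -> ne;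
  rewrite ?(mulr1, mulrN1, opprK) // in ne *;
  congr (_, _, _); apply: corrE; by rewrite /row_cov /row_var; field.
Qed.

(** * Convergence of all orbits and absence of cycles *)

Lemma T_gram s : E3nd s -> exists p q r,
  planar_gram (T s).1.1 (T s).1.2 (T s).2 p q r.
Proof.
case=> _ nc; have [p [q [r g]]] := corr_gram (nc (inord 0)) (nc (inord 1)) (nc (inord 2)).
by exists p, q, r; rewrite /T !mxE.
Qed.

Lemma settles_T s : settles (T s) -> settles s.
Proof.
move=> [l ne lim]; exists l => //.
have pred_oo : (fun k => k.-1) @ \oo --> \oo.
  apply/cvgnyPge => N; near=> k.
  have : (N < k)%N by near: k; exact: nbhs_infty_gt.
  by case: (k) => // k'; rewrite ltnS.
have := cvg_comp _ _ pred_oo lim; apply: cvg_trans; apply: near_eq_cvg.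
near=> k; rewrite /= -iterSr prednK //.
by near: k; exact: nbhs_infty_gt.
Unshelve. all: by end_near.
Qed.

Lemma settles_fixed s : s <> (1, 1, 1) -> T s = s -> settles s.
Proof.
move=> ne fs; exists s => //.
have -> : (fun k => iter k (@T R) s) = fun=> s.
  by apply/funext => k; elim: k => //= k ->.
exact: cvg_cst.
Qed.

(** If q = 0 is the middle cross product, the triangle inequality forces
r = - p, so p + q + r = 0: either two vectors coincide or all are parallel. The
scatter matrix is then singular and a single step makes all vectors parallel. *)
Lemma collapse_settles a b c p r : planar_gram a b c p 0 r -> (a, b, c) <> (1, 1, 1) ->
  0 <= p -> r <= 0 -> settles (a, b, c).
Proof.
move=> g ne p0 r0.
have nd : E3nd (a, b, c) by apply/E3ndP; split=> //; exact: gram_E3 g.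
have [m1 m2 m3] := E3_row_var_gt0 (gram_E3 g) ne.
have sigma0 : p + 0 + r = 0.
  have := gram_cosine g; rewrite mulr0 mulr0 expr0n /= !addr0.
  by move=> /eqP; rewrite eqf_sqr => /orP[] /eqP rp; lra.
have := gram_step g m1 m2 m3 => /=.
rewrite sigma0 !mulr0 !mul0r => g0.
have ne' : T (a, b, c) <> (1, 1, 1) by have /E3ndP[] := T_E3nd nd.
apply/settles_T/settles_fixed => //.
by move: ne'; rewrite [T (a, b, c)]T_row_corr; exact: vertex_fixed.
Qed.

Lemma E3nd_settles s : E3nd s -> settles s.
Proof.
move=> nd; apply: settles_T; have [p [q [r]]] := T_gram nd.
have /E3ndP[_] := T_E3nd nd.
case: (T s) => [[a b] c] /= ne g; move: a b c p q r g ne.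
apply: settles_sorted => a b c p q r g ne qp rq.
rewrite le_eqVlt => /orP[/eqP q0|q0]; last first.
  have [e e2] := ordered_oriented (And4 g qp rq q0).
  exact: oriented_settles.
rewrite -q0 in g qp rq; exact: collapse_settles g ne qp rq.
Qed.

Lemma settles_limit_fixed s l : E3nd s -> l <> (1, 1, 1) ->
  ((fun k => iter k (@T R) s) @ \oo --> l) -> E3nd l /\ T l = l.
Proof.
case: l => [[x y] z] nd ne lim; have [cx cy cz] := cvg_tripleP lim.
have ndk k : E3nd (iter k (@T R) s) by elim: k => //= k /T_E3nd.
have itv (u : nat -> R) (l : R) : u @ \oo --> l -> (forall k, -1 <= u k <= 1) ->
    -1 <= l <= 1.
  move=> ul h; apply/andP; split.
    apply: (@ler_cvg_to _ _ _ _ (fun=> -1) u _ _ (cvg_cst _) ul).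
    by near=> k; have /andP[] := h k.
  apply: (@ler_cvg_to _ _ _ _ u (fun=> 1) _ _ ul (cvg_cst _)).
  by near=> k; have /andP[] := h k.
have El : E3 (x, y, z).
  have ek k : let u := iter k (@T R) s in
    [/\ -1 <= u.1.1 <= 1, -1 <= u.1.2 <= 1, -1 <= u.2 <= 1 &
     0 <= 1 + 2 * u.1.1 * u.1.2 * u.2 - u.1.1 ^+ 2 - u.1.2 ^+ 2 - u.2 ^+ 2].
    by have [+ _] := ndk k; case: (iter k _ _) => [[]].
  split.
  - by apply: itv cx _ => k; have [] := ek k.
  - by apply: itv cy _ => k; have [] := ek k.
  - by apply: itv cz _ => k; have [] := ek k.
  apply: (@ler_cvg_to nat \oo _ R (fun=> 0) (fun k => let u := iter k (@T R) s in
      1 + 2 * u.1.1 * u.1.2 * u.2 - u.1.1 ^+ 2 - u.1.2 ^+ 2 - u.2 ^+ 2)).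
  - exact: cvg_cst.
  - by repeat first [exact: cx|exact: cy|exact: cz|exact: cvg_cst|
    apply: cvg_sqr|apply: cvgB|apply: cvgD|apply: cvgM].
  - by near=> k; have [] := ek k.
split; first by apply/E3ndP.
have [v1 v2 v3] := E3_row_var_gt0 El ne.
have lim1 : (fun k => iter k.+1 (@T R) s) @ \oo --> (x, y, z).
  apply: cvg_comp lim; apply/cvgnyPge => N; near=> k; apply: leqW.
  by near: k; exact: nbhs_infty_ge.
suff lim2 : (fun k => iter k.+1 (@T R) s) @ \oo --> T (x, y, z).
  exact: (cvg_unique (@norm_hausdorff R (R * R * R)%type) lim2 lim1).
have -> : (fun k => iter k.+1 (@T R) s) = fun k => let u := iter k (@T R) s in
   (row_corr u.1.1 u.1.2 u.2, row_corr u.1.2 u.1.1 u.2, row_corr u.2 u.1.1 u.1.2).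
  by apply/funext => k /=; case: (iter k _ _) => [[a b] c]; rewrite T_row_corr.
rewrite T_row_corr; apply: cvg_triple; apply: cvg_row_corr; rewrite // row_varC //.
Unshelve. all: by end_near.
Qed.

Lemma omega_limit s l : E3 l -> (fun k => iter k (@T R) s) @ \oo --> l ->
  omega s = [set l].
Proof.
move=> El lim; apply/seteqP; split=> [l' [_ [k [k_oo lim']]]|_ ->].
  have sub : (fun j => iter (k j) (@T R) s) @ \oo --> l by exact: cvg_comp k_oo lim.
  exact: (cvg_unique (@norm_hausdorff R (R * R * R)%type) lim' sub).
by split=> //; exists id; split=> //; exact: cvg_id.
Qed.

Lemma E3nd_limit s : E3nd s -> exists l,
  [/\ E3nd l, T l = l & (fun k => iter k (@T R) s) @ \oo --> l].
Proof.
move=> nd; have [l ne lim] := E3nd_settles nd; exists l.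
by have [] := settles_limit_fixed nd ne lim.
Qed.

(** The constant subsequence of multiples of m has the same limit as the orbit,
which is a fixed point. *)
Lemma periodic_fixed s m : E3nd s -> (0 < m)%N -> iter m (@T R) s = s -> T s = s.
Proof.
move=> nd m0 per; have [l [_ fl lim]] := E3nd_limit nd.
have per_k j : iter (j * m) (@T R) s = s.
  by elim: j => //= j IH; rewrite mulSn iterD IH.
have k_oo : (fun j => j * m)%N @ \oo --> \oo.
  apply/cvgnyPge => N; near=> j; rewrite (@leq_trans j) //; last by rewrite leq_pmulr.
  by near: j; exact: nbhs_infty_ge.
have sub : (fun j => iter (j * m) (@T R) s) @ \oo --> l by exact: cvg_comp k_oo lim.
have cst : (fun j => iter (j * m) (@T R) s) @ \oo --> s.
  by under eq_fun do rewrite per_k; exact: cvg_cst.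
by rewrite (cvg_unique (@norm_hausdorff R (R * R * R)%type) cst sub).
Unshelve. all: by end_near.
Qed.

Lemma corr_map_A3 (A : 'M[R]_3) : nonconstant_rows A ->
  exists2 s, E3 s & corr_map A = A3 s.
Proof.
move=> nc; have [p [q [r g]]] := corr_gram (nc (inord 0)) (nc (inord 1)) (nc (inord 2)).
eexists; first exact: gram_E3 g.
apply/matrixP; apply: ord3_ind; apply: ord3_ind; rewrite !mxE !inordK //=;
 by rewrite ?corrxx // corrC.
Qed.

(** A periodic matrix is an iterate of the correlation map, hence of the form
A3 s, and its orbit is that of s under T. *)
Lemma corr_map_periodic_fixed (A : 'M[R]_3) m : (0 < m)%N ->
  (forall n, nonconstant_rows (iter n (@corr_map R) A)) ->
  iter m (@corr_map R) A = A -> corr_map A = A.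
Proof.
case: m => // m _ nc per.
have [s Es AE] := corr_map_A3 (nc m).
rewrite -iterS per in AE.
have nd : E3nd s by split=> //; rewrite -AE; exact: (nc 0).
have iterE n : iter n (@corr_map R) A = A3 (iter n (@T R) s) /\ E3nd (iter n (@T R) s).
  elim: n => [|n [IH ndn]]; first by [].
  rewrite !iterS.
  by split; [rewrite IH A3_T //; case: ndn|exact: T_E3nd].
have A3_inj : injective (@A3 R).
  move=> [[a b] c] [[a' b'] c'] /matrixP h.
  have := h (inord 0) (inord 1); have := h (inord 0) (inord 2).
  have := h (inord 1) (inord 2).
  by rewrite !mxE !inordK //= => -> -> ->.
have Ts : T s = s.
  apply: periodic_fixed nd (ltn0Sn m) _; apply: A3_inj.
  by rewrite -(iterE m.+1).1 per.
by rewrite AE -A3_T ?Ts //; case: nd.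
Qed.

End CorrelationDynamics.

Unset Implicit Arguments.

Theorem corollary6 (R : realType) :
  [/\ ~ (exists (A : 'M[R]_3) (m : nat),
           (1 < m)%N /\ prime_period (@nonconstant_rows R) (@corr_map R) A m),
      ~ (exists (p : R * R * R) (m : nat),
           (1 < m)%N /\ prime_period (@E3nd R) (@T R) p m) &
      forall p : R * R * R, E3nd p ->
        exists q : R * R * R, [/\ E3nd q, T q = q & omega p = [set q]]].
Proof.
split.
- move=> [A [m [m1 [m0 nc per min]]]]; apply: (min 1%N); first by rewrite m1.
  exact: corr_map_periodic_fixed m0 nc per.
- move=> [p [m [m1 [m0 nd per min]]]]; apply: (min 1%N); first by rewrite m1.
  exact: periodic_fixed (nd 0%N) m0 per.
move=> p nd; have [q [ndq Tq lim]] := E3nd_limit nd; exists q; split=> //.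
by apply: omega_limit lim; case: ndq.
Qed.
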